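(* Let $t\geq 2$ be an integer, let $k$ be an odd positive integer, and let $G=D(1,2,\dots,t)$. Then $\mathrm{rl}_k(G)\leq \frac t2 k^2+\frac t2 k$.
   Context: For a finite set $D=\{d_1<\dots<d_m\}$ of positive integers, the distance graph $D(d_1,\dots,d_m)$ has vertex set $\mathbb{Z}$, two distinct integers $i,j$ being adjacent iff $|i-j|\in D$. For a connected graph $G$ with graph distance $d(\cdot,\cdot)$ and an integer $k\ge 1$, a radio $k$-labeling of $G$ is a map $c:V(G)\to\mathbb{Z}_{\ge 0}$ such that $|c(u)-c(v)|\geq k+1-d(u,v)$ for all distinct vertices $u,v$. Its span is $\max\{c(x)-c(y): x,y\in V(G)\}$ (a supremum for infinite graphs), and the radio $k$-labeling number $\mathrm{rl}_k(G)$ is the minimum span over all radio $k$-labelings of $G$. *)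

(* Defs.v *)
From mathcomp Require Import all_boot all_order all_algebra.

Set Implicit Arguments.
Unset Strict Implicit.
Unset Printing Implicit Defensive.

Import Order.TTheory GRing.Theory Num.Theory.
Local Open Scope ring_scope.

Definition is_minimum (P : nat -> Prop) (n : nat) : Prop :=
  P n /\ forall m : nat, P m -> (n <= m)%N.

Definition distance_graph (D : seq nat) : rel int :=
  fun i j => (i != j) && (`|i - j|%N \in D).

Section RadioLabeling.
Variables (V : Type) (G : rel V).

Definition walk_of_length (u v : V) (n : nat) : Prop :=
  exists p : seq V, [/\ path G u p, last u p = v & size p = n].

(* No [n] satisfies this when [u] and [v] lie in different components. *)
Definition is_graph_dist (u v : V) (n : nat) : Prop :=
  is_minimum (walk_of_length u v) n.

(* The right-hand side is a subtraction in [int], hence not truncated. *)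
Definition radio_labeling (k : nat) (c : V -> nat) : Prop :=
  forall (u v : V) (d : nat), u <> v -> is_graph_dist u v d ->
    `|(c u)%:Z - (c v)%:Z| >= k%:Z + 1 - d%:Z.

(* The supremum of the differences is their least upper bound; a labeling
   with unbounded differences has no span in [nat]. *)
Definition is_span (c : V -> nat) (s : nat) : Prop :=
  is_minimum (fun b => forall x y : V, (c x)%:Z - (c y)%:Z <= b%:Z) s.

(* Labelings of infinite span never compete for the minimum; if there were no
   labeling of finite span, no [n] would satisfy this. *)
Definition is_radio_number (k n : nat) : Prop :=
  is_minimum (fun s => exists c, radio_labeling k c /\ is_span c s) n.

End RadioLabeling.

(* Main.v *)
Require Import Defs.
From Stdlib Require Import Classical.
From mathcomp Require Import all_boot all_order all_algebra.
From mathcomp Require Import zify ring.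

Import Order.TTheory GRing.Theory Num.Theory.
Local Open Scope ring_scope.

(** Write [k = 2 m + 1] and [n = k t + 1], and label [Z] periodically with period
    [n].  Vertices in the same class modulo [n] are at distance at least [k + 1],
    so they may share a label.  The classes are ordered as
    [0, h, 1, h + 1, 2, ...] with [h = ceil (n / 2)], and the class in position
    [p] receives the label [(m + 1) p].  Consecutive classes differ by [h] or
    [1 - h] modulo [n], which forces a distance of at least [m + 1] because
    [t >= 2]; all other labels differ by at least [2 (m + 1) = k + 1].  The
    largest label is [(m + 1) (n - 1) = t k (k + 1) / 2]. *)

(** Serves twice: the span and the radio number are minima over possibly undecidable predicates, so
    each must be shown to exist before it is bounded. *)
Lemma exists_minimum_le (P : nat -> Prop) (n : nat) :
  P n -> exists m : nat, is_minimum P m /\ (m <= n)%N.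
Proof.
elim/ltn_ind: n => n IHn Pn.
case: (classic (exists2 m, P m & (m < n)%N)) => [[m Pm lt_mn]|nlt].
  have [l [min_l le_lm]] := IHn m lt_mn Pm.
  by exists l; split; rewrite // (leq_trans le_lm) // ltnW.
exists n; split=> //; split=> // m Pm.
by rewrite leqNgt; apply/negP => lt_mn; apply: nlt; exists m.
Qed.

Lemma distance_graph_walk_bound (t : nat) (u v : int) (d : nat) :
  walk_of_length (distance_graph (iota 1 t)) u v d -> (`|u - v| <= d * t)%N.
Proof.
case=> p [+ + <-]; elim: p u => [|w p IHp] u /=.
  by move=> _ ->; rewrite subrr.
case/andP => /andP[_]; rewrite mem_iota => uw pw lastp.
have := IHp w pw lastp.
by rewrite mulSn; lia.
Qed.

(** Inverse of the order [0, h, 1, h + 1, ...]: the position of the class [r] in it. *)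
Definition interleave (h r : nat) : nat :=
  if (r < h)%N then r.*2 else (r - h).*2.+1.

Lemma interleave_bound (n r : nat) :
  (r < n)%N -> (interleave (uphalf n) r < n)%N.
Proof. by rewrite /interleave; case: ifP; lia. Qed.

(** Adjacent positions have opposite parity, so [h] separates the residues: these go up by [h], then
    down by [h - 1]. *)
Lemma interleave_adjacent (h r s : nat) : r != s ->
  (`|(interleave h r)%:Z - (interleave h s)%:Z| < 2)%N ->
  interleave h r <> interleave h s /\ (h.-1 <= `|r%:Z - s%:Z| <= h)%N.
Proof. by rewrite /interleave; case: ifP; case: ifP; lia. Qed.

Definition interleaved_label (n a : nat) (i : int) : nat :=
  (a * interleave (uphalf n) `|(i %% n)%Z|)%N.

Lemma interleaved_label_bound (n a : nat) (i : int) :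
  (0 < n)%N -> (interleaved_label n a i <= a * n.-1)%N.
Proof.
move=> n_gt0; rewrite leq_mul2l; apply/orP; right.
have := interleave_bound n `|(i %% n)%Z|; lia.
Qed.

Lemma radio_interleaved_label (t m : nat) : (2 <= t)%N ->
  radio_labeling (distance_graph (iota 1 t)) m.*2.+1
    (interleaved_label (m.*2.+1 * t).+1 m.+1).
Proof.
move=> t_ge2 u v d neq_uv [/distance_graph_walk_bound + _].
rewrite /interleaved_label.
set n := (_ * t).+1.
have n_neq0 : n%:Z != 0 by [].
have nE : n = (2 * (m * t) + t + 1)%N by rewrite /n; lia.
have := divz_eq u n; have := divz_eq v n.
have := modz_ge0 u n_neq0; have := modz_ge0 v n_neq0.
have := ltz_pmod u (isT : 0 < n%:Z); have := ltz_pmod v (isT : 0 < n%:Z).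
move: (u %/ n)%Z (v %/ n)%Z (u %% n)%Z (v %% n)%Z => qu qv [ru|//] [rv|//].
rewrite !absz_nat => rv_lt ru_lt _ _ vE uE dist.
have uvE : u - v = (qu - qv) * n%:Z + (ru%:Z - rv%:Z).
  by rewrite uE vE; ring.
(* Linear bounds on the product, so that [lia] can do the distance estimates. *)
have far : (qu = qv) \/ ((qu - qv) * n%:Z >= n%:Z) \/ ((qu - qv) * n%:Z <= - n%:Z).
  by clear -nE; nia.
have d_ge (b : nat) : (b * t < `|u - v|)%N -> (b < d)%N.
  by move=> lt_b; rewrite -(ltn_pmul2r (ltnW t_ge2)) (leq_trans lt_b).
have [eq_r|neq_r] := eqVneq ru rv.
  have : (m.*2.+1 < d)%N.
    apply: d_ge; rewrite -/n.
    have neq_q : qu <> qv by move=> eq_q; apply: neq_uv; rewrite uE vE eq_q eq_r.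
    by clear -far uvE eq_r neq_q; move: n far uvE => n' far uvE; lia.
  by clear; lia.
have := interleave_adjacent (uphalf n) ru rv neq_r.
move: (interleave _ ru) (interleave _ rv) => pu pv adj.
have [far_p|near_p] := leqP 2 `|pu%:Z - pv%:Z|.
  by clear -far_p; nia.
have [neq_p diff_r] := adj near_p.
(* With [h = uphalf n], [|u - v|] is at least the smaller of [h - 1] and [n - h]; both exceed
   [m * t] as [t >= 2]. *)
have : (m < d)%N.
  apply: d_ge.
  clear -diff_r nE far uvE t_ge2 ru_lt rv_lt.
  move: (m * t)%N nE far uvE diff_r ru_lt rv_lt => mt nE.
  by move: (n) nE => n' nE far uvE diff_r ru_lt rv_lt; lia.
by clear -neq_p; nia.
Qed.

Theorem theorem3 (t k : nat) (ht : (2 <= t)%N) (hk : odd k) :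
  exists rl : nat,
    is_radio_number (distance_graph (iota 1 t)) k rl /\
    rl%:R <= t%:R / 2%:R * k%:R ^+ 2 + t%:R / 2%:R * k%:R :> rat.
Proof.
have [m ->] : exists m, k = m.*2.+1 by exists k./2; lia.
set n := (m.*2.+1 * t).+1; set c := interleaved_label n m.+1.
have c_span (x y : int) : (c x)%:Z - (c y)%:Z <= (m.+1 * n.-1)%N%:Z.
  by have := interleaved_label_bound n m.+1 x isT; rewrite -/c; lia.
have [s [c_s s_le]] := exists_minimum_le
  (fun b => forall x y : int, (c x)%:Z - (c y)%:Z <= b%:Z) _ c_span.
have [rl [rl_min rl_le]] := exists_minimum_le
  (fun s => exists c, radio_labeling (distance_graph (iota 1 t)) m.*2.+1 c /\
     is_span c s) s (ex_intro _ c (conj (radio_interleaved_label t m ht) c_s)).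
exists rl; split=> //.
have := leq_trans rl_le s_le; rewrite -(ler_nat rat) => /le_trans; apply.
rewrite /n /= !natrM -!natr1 -mul2n natrM.
(* The bound [(m + 1) (n - 1)] equals the target exactly. *)
by rewrite le_eqVlt; apply/orP; left; apply/eqP; field.
Qed.
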